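(* Let $\Gamma$ be a group acting by isometries on a simply-connected geodesic metric space $(X,d)$, let $S\subset\Gamma$ be a finite symmetric generating set for $\Gamma$, and let $0\in X$ be a fixed point of reference (base point). Let $\mathcal F_S=\{x\in X: d(0,x)\le d(g.0,x)\ \text{for all}\ g\in S\}$, suppose that $d(0,x)$ is bounded on $\mathcal F_S$, and put $r_0=\sup\{d(0,x):x\in\mathcal F_S\}$. Suppose that there is a number $r_1>2r_0$ such that (a) if $g\in S$, then $d(g.0,0)\le r_1$; and (b) if $g,g'\in S$ and $d((gg').0,0)\le r_1$, then $gg'\in S$. Then $S=\{g\in\Gamma: d(g.0,0)\le r_1\}$.
   Context: A subset $S$ of a group is symmetric if $g\in S$ implies $g^{-1}\in S$. A geodesic metric space is one in which any two points are joined by a geodesic segment (an isometrically embedded interval whose length is the distance between the points). The base point $0$ is an arbitrary chosen point of $X$; it is not assumed to be fixed by $\Gamma$. The action of $g\in\Gamma$ on $x\in X$ is written $g.x$.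
   Formalization: The generating set S is assumed nonempty; for S empty (which generates only the trivial group) the stated equality fails, since the right-hand side always contains the identity. *)

(* Defs.v *)
From mathcomp Require Import all_boot all_order all_algebra.
From mathcomp Require Import all_classical all_reals all_analysis.

Set Implicit Arguments.
Unset Strict Implicit.
Unset Printing Implicit Defensive.

Import Order.TTheory GRing.Theory Num.Theory.
Import numFieldNormedType.Exports.

Local Open Scope classical_set_scope.
Local Open Scope ring_scope.

Definition geodesic_space (R : realType) (X : metricType R) : Prop :=
  forall x y : X, exists c : R -> X,
    [/\ c 0 = x, c (mdist x y) = y &
        {in `[0, mdist x y] &, forall s t, mdist (c s) (c t) = `|s - t|}].

Definition path_connected_space (R : realType) (X : topologicalType) : Prop :=
  forall x y : X, exists c : R -> X,
    [/\ {within `[0, 1], continuous c}, c 0 = x & c 1 = y].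

(* [H (s, t)] is the position at time [t] of the loop reached at stage [s] of
   a homotopy relative to the endpoints, from [c] to the constant loop. *)
Definition nullhomotopic_loop (R : realType) (X : topologicalType)
    (c : R -> X) : Prop :=
  exists H : R * R -> X,
    [/\ {within `[0, 1] `*` `[0, 1], continuous H},
        {in `[0, 1], forall t, H (0, t) = c t},
        {in `[0, 1], forall t, H (1, t) = c 0} &
        {in `[0, 1], forall s, H (s, 0) = c 0 /\ H (s, 1) = c 0}].

Definition simply_connected_space (R : realType) (X : topologicalType) : Prop :=
  path_connected_space R X /\
  forall c : R -> X, {within `[0, 1], continuous c} -> c 0 = c 1 ->
    nullhomotopic_loop c.

Definition isometric_action (R : realType) (G : groupType) (X : metricType R)
    (act : G -> X -> X) : Prop :=
  [/\ forall x, act 1%g x = x,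
      forall g h x, act (g * h)%g x = act g (act h x) &
      forall g x y, mdist (act g x) (act g y) = mdist x y].

Definition symmetric_subset (G : groupType) (S : set G) : Prop :=
  forall g, S g -> S (g^-1)%g.

Definition generated_subgroup (G : groupType) (S : set G) : set G :=
  smallest [set H : set G | group_closed [in H]] S.

Definition FS (R : realType) (G : groupType) (X : metricType R)
    (act : G -> X -> X) (o : X) (S : set G) : set X :=
  [set x | forall g, S g -> mdist o x <= mdist (act g o) x].

(* Main.v *)
(** Call [g] and [h] adjacent when [g^-1 * h] is in [S].  By (b), adjacency is
    transitive as long as the centers [g.0] and [k.0] at the two ends of the
    chain stay within [r1] of each other.  A minimality argument over the
    finite set [S] shows that a point within [r1 / 2] of [g.0] is within [r0]
    of [h.0] for some [h] adjacent to [g].  So a path in [X] lifts to a locally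
    adjacent [G]-valued map whose value at each time is a center within [r0] of
    the path, and since [2 * r0 < r1] nearby paths have adjacent lifts: this is
    a covering space argument carried out with adjacency in place of
    equality.  Subdividing a null-homotopy, the two ends of a lift of a loop
    are adjacent.  If [d (g.0, 0) <= r1], a loop through the midpoint of [0] and
    [g.0], running from [0] to [g.0] along a word in [S], gives that [1] and
    [g] are adjacent. *)

Require Import Defs.
From mathcomp Require Import all_boot all_order all_algebra.
From mathcomp Require Import all_classical all_reals all_analysis.
From mathcomp Require Import lra.
Import Order.TTheory GRing.Theory Num.Theory.
Import numFieldNormedType.Exports.

Local Open Scope classical_set_scope.
Local Open Scope ring_scope.

Set Implicit Arguments.
Unset Strict Implicit.
Unset Printing Implicit Defensive.

(** * Finite minima and uniform continuity on compact sets *)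

Lemma finite_set_has_argmin (R : realDomainType) (T : choiceType) (A : set T)
    (f : T -> R) :
  finite_set A -> A !=set0 -> exists2 a, A a & forall b, A b -> f a <= f b.
Proof.
move=> /finite_seqP[s ->] [y ys]; move: (ys).
pose s0 : seq_sub s := SeqSub ys.
case: (arg_minP (fun x : seq_sub s => f (val x)) (erefl : predT s0)) => x _ xmin _.
exists (val x); first exact: ssvalP.
by move=> b bs; exact: (xmin (SeqSub bs)).
Qed.

Lemma continuous_compact_uniform (R : realType) (T : pseudoMetricType R)
    (X : metricType R) (K : set T) (f : T -> X) (e : R) :
  compact K -> {within K, continuous f} -> 0 < e ->
  exists2 d, 0 < d & forall p q, K p -> K q -> ball p d q ->
    mdist (f p) (f q) < e.
Proof.
move=> /compact_near_coveringP/near_covering_withinP cK.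
move=> /subspace_continuousP cf e0.
(* The uniform radius is found as a parameter tending to [0] from the right: near each point some
   range of radii works, and compactness gives a common one. *)
have {}cK := cK R 0^'+ (fun d p => forall q, K q -> ball p d q ->
  mdist (f p) (f q) < e).
have [|d /= d0 dP] := cK _ _.
  move=> x Kx.
  have e20 : 0 < e / 2 by rewrite divr_gt0.
  have := metricType_numDomainType.cvgr_dist_lt (cf x Kx) e20.
  rewrite near_withinE => /(_ _)/nbhs_ballP[d /= d0 dP].
  have d20 : 0 < d / 2 by rewrite divr_gt0.
  exists (ball x (d / 2), [set r | 0 < r < d / 2]) => /=.
    split; first exact: nbhsx_ballx.
    exists (d / 2) => //= r /=; rewrite sub0r normrN => rd r0.
    by rewrite r0 (le_lt_trans (ler_norm _) rd).
  move=> [x' r] /= [xx' /andP[r0 rd]] Kx' q Kq x'q.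
  have h1 : mdist (f x) (f x') < e / 2.
    by apply: dP => //; apply: le_ball xx'; lra.
  have h2 : mdist (f x) (f q) < e / 2.
    apply: dP => //; rewrite [d]splitr; apply: ball_triangle xx' _.
    by apply: le_ball x'q; exact: ltW.
  have := metric_triangle (f x') (f x) (f q).
  by rewrite (metric_sym (f x') (f x)); lra.
exists (d / 2); first by rewrite divr_gt0.
move=> p q Kp Kq; apply: (dP (d / 2)) => //=; last by rewrite divr_gt0.
by rewrite sub0r normrN gtr0_norm ?divr_gt0 //; lra.
Qed.

Lemma lipschitz_within_continuous (R : realType) (X : metricType R)
    (a b K : R) (c : R -> X) :
  (forall s t, a <= s <= b -> a <= t <= b ->
    mdist (c s) (c t) <= K * `|s - t|) ->
  {within `[a, b], continuous c}.
Proof.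
move=> cK; apply/subspace_continuousP => x /=; rewrite in_itv /= => xab.
apply/metricType_numDomainType.cvgrPdist_lt => e e0.
rewrite near_withinE; apply/nbhs_ballP.
(* The added [1] keeps the divisor positive whatever the sign of [K]. *)
have K0 : 0 < `|K| + 1 by rewrite ltr_wpDl.
exists (e / (`|K| + 1)); first by rewrite /= divr_gt0.
move=> y /= xy; rewrite in_itv /= => yab.
apply: (le_lt_trans (cK _ _ xab yab)).
move: xy; rewrite -ball_normE /= ltr_pdivlMr // mulrC; apply: le_lt_trans.
by rewrite ler_wpM2r // (le_trans (ler_norm K)) // lerDl.
Qed.

(** * Adjacency of group elements *)

Section Chambers.

Variables (R : realType) (G : groupType) (X : metricType R).
Variables (act : G -> X -> X) (S : set G) (o : X) (r0 r1 : R).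

Hypothesis geoX : geodesic_space X.
Hypothesis actI : isometric_action act.
Hypothesis S_finite : finite_set S.
Hypothesis S_neq0 : S !=set0.
Hypothesis S_sym : symmetric_subset S.
Hypothesis S_gen : generated_subgroup S = [set: G].
Hypothesis FS_ball : forall x, FS act o S x -> mdist o x <= r0.
Hypothesis r0r1 : 2 * r0 < r1.
Hypothesis S_ball : forall g, S g -> mdist (act g o) o <= r1.
Hypothesis S_mul :
  forall g g', S g -> S g' -> mdist (act (g * g')%g o) o <= r1 -> S (g * g')%g.

Let act1 x : act 1%g x = x. Proof. by case: actI. Qed.
Let actM g h x : act (g * h)%g x = act g (act h x). Proof. by case: actI. Qed.
Let mdist_act g x y : mdist (act g x) (act g y) = mdist x y.
Proof. by case: actI. Qed.

Let r0_ge0 : 0 <= r0.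
Proof.
by rewrite -(mdistxx o); apply: FS_ball => g _; rewrite mdistxx mdist_ge0.
Qed.

Lemma one_in_generators : S 1%g.
Proof.
have [s Ss] := S_neq0; rewrite -(mulgV s); apply: S_mul => //; first exact: S_sym.
rewrite mulgV act1 mdistxx.
by have := r0_ge0; have := r0r1; lra.
Qed.

Definition adjacent (g h : G) := S (g^-1 * h)%g.

Lemma adjacent_refl g : adjacent g g.
Proof. by rewrite /adjacent mulVg; exact: one_in_generators. Qed.

Lemma adjacent_sym g h : adjacent g h -> adjacent h g.
Proof. by move=> /S_sym; rewrite /adjacent invgM invgK. Qed.

Lemma adjacent_trans h g k : adjacent g h -> adjacent h k ->
  mdist (act g o) (act k o) <= r1 -> adjacent g k.
Proof.
move=> gh hk gk; rewrite /adjacent.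
have -> : (g^-1 * k = (g^-1 * h) * (h^-1 * k))%g.
  by rewrite -mulgA mulVKg.
apply: S_mul => //; rewrite -mulgA mulVKg.
by rewrite -(mdist_act g) -actM mulVKg metric_sym.
Qed.

(** Take [s] in [S] with [(g * s).0] closest to [x]. If [(g * s)^-1.x] were outside [FS], some [h]
    in [S] would put [(g * s * h).0] strictly closer to [x]. As [1] is in [S], both this center and
    [g.0] lie within [r1 / 2] of [x], so (b) puts [s * h] in [S], against minimality. *)
Lemma adjacent_near g x : mdist (act g o) x <= r1 / 2 ->
  exists2 h, adjacent g h & mdist (act h o) x <= r0.
Proof.
move=> gx.
have [s Ss smin] := finite_set_has_argmin (fun s => mdist (act (g * s)%g o) x)
  S_finite S_neq0.
exists (g * s)%g; first by rewrite /adjacent mulKg.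
pose y := act (g * s)^-1%g x.
have yE k : mdist (act k o) y = mdist (act (g * s * k)%g o) x.
  by rewrite -(mdist_act (g * s)%g) -!actM mulgV act1.
suff : FS act o S y by move=> /FS_ball; rewrite -{1}(act1 o) yE mulg1.
move=> h Sh; rewrite -{1}(act1 o) !yE mulg1 leNgt; apply/negP => lt_h.
have /smin : S (s * h)%g.
  apply: S_mul => //.
  have := smin _ one_in_generators; rewrite mulg1 => sg.
  have := metric_triangle (act (g * (s * h))%g o) x (act g o).
  rewrite {1}(actM g) mdist_act (metric_sym x) => shx.
  by move: lt_h; rewrite -mulgA => lt_h; lra.
by rewrite mulgA leNgt lt_h.
Qed.

Lemma adjacent_step : {step : G -> X -> G |
  forall g x, mdist (act g o) x <= r1 / 2 ->
    adjacent g (step g x) /\ mdist (act (step g x) o) x <= r0}.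
Proof.
have /choice[f fP] : forall p : G * X, exists h,
    mdist (act p.1 o) p.2 <= r1 / 2 ->
    adjacent p.1 h /\ mdist (act h o) p.2 <= r0.
  move=> [g x] /=.
  have [/adjacent_near[h gh hx]|] := pselect (mdist (act g o) x <= r1 / 2).
    by exists h.
  by exists 1%g.
by exists (fun g x => f (g, x)) => g x; exact: (fP (g, x)).
Qed.

(** * Lipschitz paths and their lifts *)

Lemma mdist_of_near g h x y : mdist (act g o) x <= r0 ->
  mdist (act h o) y <= r0 -> mdist (act g o) (act h o) <= 2 * r0 + mdist x y.
Proof.
move=> gx hy.
have := metric_triangle (act g o) x (act h o).
have := metric_triangle x y (act h o).
by rewrite (metric_sym y); lra.
Qed.

(* A Lipschitz path [c] from [x] to [y] with a lift [f] from [g] to [h]. *)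
Definition reach (x : X) (g : G) (y : X) (h : G) := exists K c f,
  [/\ [/\ c 0 = x, c 1 = y, f 0 = g & f 1 = h], 0 <= K :> R,
      forall s t : R, 0 <= s <= 1 -> 0 <= t <= 1 ->
        mdist (c s) (c t) <= K * `|s - t|,
      forall t : R, 0 <= t <= 1 -> mdist (act (f t) o) (c t) <= r0 &
      exists2 d : R, 0 < d & forall s t, 0 <= s <= 1 -> 0 <= t <= 1 ->
        `|s - t| <= d -> adjacent (f s) (f t)].

Lemma reach_refl x g : mdist (act g o) x <= r0 -> reach x g x g.
Proof.
move=> gx; exists 0, (fun=> x), (fun=> g); split=> //.
- by move=> s t _ _; rewrite mdistxx mul0r.
- by exists 1 => // s t _ _ _; exact: adjacent_refl.
Qed.

Lemma reach_sym x g y h : reach x g y h -> reach y h x g.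
Proof.
move=> [K [c [f [[<- <- <- <-] K0 cK fc [d d0 fd]]]]].
exists K, (fun t => c (1 - t)), (fun t => f (1 - t)).
have rev (t : R) : 0 <= t <= 1 -> 0 <= 1 - t <= 1 by lra.
have revB (s t : R) : `|s - t| = `|(1 - s) - (1 - t)|.
  by rewrite distrC; congr `|_|; lra.
split=> //; first by rewrite subr0 subrr.
- by move=> s t /rev s01 /rev t01; rewrite revB; exact: cK.
- by move=> t /rev; exact: fc.
- by exists d => // s t /rev s01 /rev t01; rewrite revB; exact: fd.
Qed.

Lemma reach_trans y h x g z k : reach x g y h -> reach y h z k -> reach x g z k.
Proof.
move=> [K1 [c1 [f1 [[<- c11 <- f11] K10 cK1 fc1 [d1 d10 fd1]]]]].
move=> [K2 [c2 [f2 [[c20 <- f20 <-] K20 cK2 fc2 [d2 d20 fd2]]]]].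
pose c t := if t <= 1 / 2 then c1 (2 * t) else c2 (2 * t - 1).
pose f t := if t <= 1 / 2 then f1 (2 * t) else f2 (2 * t - 1).
(* Each half is run at double speed. *)
pose K := 2 * (K1 + K2).
have K0 : 0 <= K by rewrite /K; lra.
have cK s t : 0 <= s -> s <= t -> t <= 1 -> mdist (c s) (c t) <= K * (t - s).
  move=> s0 st t1; rewrite /c; case: (leP s (1 / 2)) => s2;
    case: (leP t (1 / 2)) => t2.
  - have := cK1 (2 * s) (2 * t); rewrite distrC ger0_norm; last by lra.
    by rewrite /K => /(_ _ _); nra.
  - have := cK1 (2 * s) 1; rewrite distrC ger0_norm; last by lra.
    have := cK2 0 (2 * t - 1); rewrite distrC ger0_norm; last by lra.
    rewrite c11 c20 => h2 h1.
    have := metric_triangle (c1 (2 * s)) y (c2 (2 * t - 1)).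
    move: (h1 ltac:(lra) ltac:(lra)) (h2 ltac:(lra) ltac:(lra)).
    by rewrite /K; nra.
  - by lra.
  - have := cK2 (2 * s - 1) (2 * t - 1); rewrite distrC ger0_norm; last by lra.
    by rewrite /K => /(_ _ _); nra.
have fc t : 0 <= t <= 1 -> mdist (act (f t) o) (c t) <= r0.
  by move=> t01; rewrite /f /c; case: (leP t (1 / 2)) => t2; [apply: fc1|apply: fc2]; lra.
have K10' : 0 < K + 1 by lra.
(* The first two bounds allow for the doubled speed. The third gives [2 * r0 + K * d <= r1], so that
   adjacency can be passed through [h] when [s] and [t] lie on opposite sides of the junction. *)
pose d := Num.min (Num.min (d1 / 2) (d2 / 2)) ((r1 - 2 * r0) / (K + 1)).
have d0 : 0 < d by rewrite !lt_min !divr_gt0 //; have := r0r1; lra.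
have fd s t : 0 <= s -> s <= t -> t <= 1 -> t - s <= d -> adjacent (f s) (f t).
  move=> s0 st t1; rewrite !le_min (ler_pdivlMr _ _ K10') => /andP[/andP[std1 std2] stK].
  have far : mdist (act (f s) o) (act (f t) o) <= r1.
    have := mdist_of_near (fc s ltac:(lra)) (fc t ltac:(lra)).
    by have := cK s t s0 st t1; nra.
  move: far; rewrite /f; case: (leP s (1 / 2)) => s2; case: (leP t (1 / 2)) => t2 far.
  - by apply: fd1; rewrite 1?distrC ?ger0_norm; lra.
  - apply: (@adjacent_trans h) => //.
    + by rewrite -f11; apply: fd1; rewrite 1?distrC ?ger0_norm; lra.
    + by rewrite -f20; apply: fd2; rewrite 1?distrC ?ger0_norm; lra.
  - by have := le_trans st t2; rewrite leNgt s2.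
  - by apply: fd2; rewrite 1?distrC ?ger0_norm; lra.
exists K, c, f; split => //.
- rewrite /c /f mulr0 mulr1.
  have -> : (0 <= 1 / 2 :> R) by lra.
  have -> : (1 <= 1 / 2 :> R) = false by apply/negbTE; rewrite -ltNge; lra.
  by have -> : 2 - 1 = 1 :> R by lra.
- move=> s t /andP[s0 s1] /andP[t0 t1]; case: (leP s t) => st.
    by rewrite distrC ger0_norm ?subr_ge0 //; exact: cK.
  have ts := ltW st.
  by rewrite metric_sym ger0_norm ?subr_ge0 //; exact: cK.
- exists d => // s t /andP[s0 s1] /andP[t0 t1]; case: (leP s t) => st.
    by rewrite distrC ger0_norm ?subr_ge0 //; exact: fd.
  have ts := ltW st; rewrite ger0_norm ?subr_ge0 // => std.
  exact/adjacent_sym/fd.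
Qed.

(** The geodesic from [x] to [g.0] stays within [r1 / 2] of [g.0], so each of its points has a lift
    adjacent to [g]. These lifts may be chosen independently: at nearby times two of them are
    adjacent through [g]. *)
Lemma reach_center g a x : mdist (act g o) x <= r1 / 2 -> adjacent g a ->
  mdist (act a o) x <= r0 -> reach x a (act g o) g.
Proof.
move=> gx ga ax; have [c [c0 cD cI]] := geoX x (act g o).
set D := mdist x _ in cD cI.
have D0 : 0 <= D := mdist_ge0 _ _.
have [step stepP] := adjacent_step.
pose p t := c (D * t).
have pK s t : 0 <= s <= 1 -> 0 <= t <= 1 -> mdist (p s) (p t) = D * `|s - t|.
  move=> s01 t01; rewrite cI ?in_itv /= -1?mulrBr ?normrM ?(ger0_norm D0) //;
    by nra.
have p0 : p 0 = x by rewrite /p mulr0.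
have p1 : p 1 = act g o by rewrite /p mulr1.
have gp t : 0 <= t <= 1 -> mdist (act g o) (p t) <= r1 / 2.
  move=> t01; rewrite metric_sym -p1 pK //; last by rewrite ler01 lexx.
  have := gx; rewrite metric_sym -/D distrC ger0_norm; last by lra.
  by nra.
(* The values at both ends are prescribed, since [step] need not return [a] and [g] there. *)
pose f t := if t == 0 then a else if t == 1 then g else step g (p t).
have fP t : 0 <= t <= 1 ->
    adjacent g (f t) /\ mdist (act (f t) o) (p t) <= r0.
  move=> t01; rewrite /f; have [->|_] := eqVneq t 0; first by rewrite p0.
  have [->|_] := eqVneq t 1; last exact/stepP/gp.
  by rewrite p1 mdistxx; split; [exact: adjacent_refl|exact: r0_ge0].
exists D, p, f; split => //.
- by rewrite /f !eqxx oner_eq0.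
- by move=> s t s01 t01; rewrite pK.
- by move=> t /fP[].
- have D10 : 0 < D + 1 by lra.
  exists ((r1 - 2 * r0) / (D + 1)); first by rewrite divr_gt0 //; have := r0r1; lra.
  move=> s t s01 t01; rewrite ler_pdivlMr // => stD.
  have [gs sp] := fP s s01; have [gt tp] := fP t t01.
  apply: adjacent_trans gt _; first exact: adjacent_sym.
  have := mdist_of_near sp tp; rewrite pK //.
  by have := normr_ge0 (s - t); nra.
Qed.

Lemma geodesic_midpoint (x y : X) :
  exists2 m, mdist x m <= mdist x y / 2 & mdist y m <= mdist x y / 2.
Proof.
have [c [c0 cD cI]] := geoX x y.
have D0 : 0 <= mdist x y := mdist_ge0 _ _.
exists (c (mdist x y / 2)).
  rewrite -[X in mdist X (c _)]c0 cI ?in_itv /=; try by lra.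
  by rewrite distrC ger0_norm; lra.
rewrite -[X in mdist X (c _)]cD cI ?in_itv /=; try by lra.
by rewrite ger0_norm; lra.
Qed.

(** The two centers may be [r1] apart, so the path goes through a midpoint [m], where [reach_center]
    applies from both sides. The lift [b] at [m] is also adjacent to [g * s], because the two
    centers are within [r1 / 2 + r0 < r1] of each other. *)
Lemma reach_mulr_generator g s : S s ->
  reach (act g o) g (act (g * s)%g o) (g * s)%g.
Proof.
move=> Ss; have [m gm gsm] := geodesic_midpoint (act g o) (act (g * s)%g o).
have gs : mdist (act g o) (act (g * s)%g o) <= r1.
  by rewrite actM mdist_act metric_sym; exact: S_ball.
have gm1 : mdist (act g o) m <= r1 / 2 by lra.
have gsm1 : mdist (act (g * s)%g o) m <= r1 / 2 by lra.
have [b gb bm] := adjacent_near gm1.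
have g_gs : adjacent g (g * s)%g by rewrite /adjacent mulKg.
have gsb : adjacent (g * s)%g b.
  apply: adjacent_trans (adjacent_sym g_gs) gb _.
  have := metric_triangle (act (g * s)%g o) m (act b o).
  by rewrite (metric_sym m); have := r0r1; lra.
apply: reach_trans (reach_center gsm1 gsb bm).
exact/reach_sym/reach_center.
Qed.

Lemma reach_group g : reach o 1%g (act g o) g.
Proof.
(* Quantifying over the starting element [g] makes this set a subgroup. *)
suff : [set: G] `<=` [set h | forall g, reach (act g o) g (act (g * h)%g o) (g * h)%g].
  by move=> /(_ g I 1%g); rewrite act1 mul1g.
rewrite -S_gen; apply: smallest_sub; last first.
  by move=> s Ss k; exact: reach_mulr_generator.
split => [|h k]; rewrite !inE /=.
  by move=> k; rewrite mulg1; apply: reach_refl; rewrite mdistxx; exact: r0_ge0.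
move=> hP kP l; rewrite mulgA; apply: reach_trans (hP l) _.
by apply: reach_sym; have := kP (l * h * k^-1)%g; rewrite mulgVK.
Qed.

(** * Lifts of discrete paths and homotopies *)

(** Since [r0 + (r1 - 2 * r0) / 2 = r1 / 2], the current center is always close enough to the next
    point for [step] to apply. *)
Lemma discrete_lift (x : nat -> X) (a : G) N :
  mdist (act a o) (x 0%N) <= r0 ->
  (forall j, (j < N)%N -> mdist (x j) (x j.+1) <= (r1 - 2 * r0) / 2) ->
  exists a' : nat -> G, [/\ a' 0%N = a,
    forall j, (j <= N)%N -> mdist (act (a' j) o) (x j) <= r0 &
    forall j, (j < N)%N -> adjacent (a' j) (a' j.+1)].
Proof.
move=> ax xe; have [step stepP] := adjacent_step.
pose a' := fix a' j := if j is j'.+1 then step (a' j') (x j) else a.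
have near j : (j < N)%N -> mdist (act (a' j) o) (x j) <= r0 ->
    mdist (act (a' j) o) (x j.+1) <= r1 / 2.
  move=> jN jx; have := metric_triangle (act (a' j) o) (x j) (x j.+1).
  by have := xe j jN; lra.
have a'x j : (j <= N)%N -> mdist (act (a' j) o) (x j) <= r0.
  by elim: j => [//|j IH] jN; apply: (stepP _ _ _).2; apply: near (IH (ltnW _)).
exists a'; split => // j jN.
by apply: (stepP _ _ _).1; apply: near (a'x _ (ltnW _)).
Qed.

(** Adjacency passes from [a j.+1] to [b j] through [a j], then to [b j.+1] through [b j]. The
    points [x j.+1] and [y j] are two small moves apart, so their centers are at most
    [2 * r0 + (r1 - 2 * r0) = r1] apart; this is why each move is limited to half of
    [r1 - 2 * r0]. *)
Lemma adjacent_lifts (x y : nat -> X) (a b : nat -> G) N :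
  (forall j, (j < N)%N -> mdist (x j) (x j.+1) <= (r1 - 2 * r0) / 2) ->
  (forall j, (j <= N)%N -> mdist (x j) (y j) <= (r1 - 2 * r0) / 2) ->
  (forall j, (j <= N)%N -> mdist (act (a j) o) (x j) <= r0) ->
  (forall j, (j <= N)%N -> mdist (act (b j) o) (y j) <= r0) ->
  (forall j, (j < N)%N -> adjacent (a j) (a j.+1)) ->
  (forall j, (j < N)%N -> adjacent (b j) (b j.+1)) ->
  adjacent (a 0%N) (b 0%N) ->
  forall j, (j <= N)%N -> adjacent (a j) (b j).
Proof.
move=> xx xy ax bx aa bb ab0; elim => [//|j IH] jN.
have jN' := ltnW jN.
have ab' : adjacent (a j.+1) (b j).
  apply: adjacent_trans (adjacent_sym (aa _ jN)) (IH jN') _.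
  have := mdist_of_near (ax _ jN) (bx _ jN').
  have := metric_triangle (x j.+1) (x j) (y j).
  by rewrite (metric_sym (x j.+1) (x j)); have := xx _ jN; have := xy _ jN'; lra.
apply: adjacent_trans ab' (bb _ jN) _.
have := mdist_of_near (ax _ jN) (bx _ jN); have := xy _ jN.
by have := r0r1; lra.
Qed.

Lemma grid_point_itv (n k : nat) : (k <= n.+1)%N ->
  0 <= (k%:R / n.+1%:R : R) <= 1.
Proof.
by move=> kn; rewrite divr_ge0 //= ler_pdivrMr // mul1r ler_nat.
Qed.

Lemma reach_loop x a b : simply_connected_space R X ->
  reach x a x b -> adjacent a b.
Proof.
move=> [_ scX] [K [c [f [[c0 c1 f0 f1] K0 cK fc [d d0 fd]]]]].
have [|H [Hcont H0 H1 Hends]] := scX c (lipschitz_within_continuous cK).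
  by rewrite c0 c1.
have e0 : 0 < (r1 - 2 * r0) / 2 by rewrite divr_gt0 //; have := r0r1; lra.
have Kcpt : compact (`[0, 1] `*` `[0, 1] : set (R * R)).
  by apply: compact_setX; exact: segment_compact.
have [d' d'0 Hd'] := continuous_compact_uniform Kcpt Hcont e0.
(* The mesh [1 / n.+1] is to be below both [d], for sampling the given lift, and [d'], for the
   homotopy. *)
pose n := Num.bound (Num.max d^-1 d'^-1).
pose u (k : nat) : R := k%:R / n.+1%:R.
have u0 : u 0%N = 0 by rewrite /u mul0r.
have u1 : u n.+1 = 1 by rewrite /u divff.
have u01 k : (k <= n.+1)%N -> 0 <= u k <= 1 := @grid_point_itv n k.
have nd : Num.max d^-1 d'^-1 < n.+1%:R.
  apply: lt_trans (archi_boundP _) _; last by rewrite ltr_nat.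
  by rewrite le_max invr_ge0 ltW.
have uS k : `|u k - u k.+1| = n.+1%:R^-1.
  by rewrite /u -mulrBl -natr1 opprD addrA subrr sub0r normrM normrN1 mul1r
    ger0_norm.
have uSd k : `|u k - u k.+1| < d.
  rewrite uS invf_plt ?posrE //; apply: le_lt_trans nd.
  by rewrite le_max lexx.
have uSd' k : `|u k - u k.+1| < d'.
  rewrite uS invf_plt ?posrE //; apply: le_lt_trans nd.
  by rewrite le_max lexx orbT.
have HS i j : (i <= n.+1)%N -> (j < n.+1)%N ->
    mdist (H (u i, u j)) (H (u i, u j.+1)) <= (r1 - 2 * r0) / 2.
  move=> iN jN; apply/ltW/Hd'.
  - by split; rewrite /= in_itv /= u01 // ltnW.
  - by split; rewrite /= in_itv /= u01.
  - by split; [exact: ballxx|rewrite -ball_normE; exact: uSd'].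
have SH i j : (i < n.+1)%N -> (j <= n.+1)%N ->
    mdist (H (u i, u j)) (H (u i.+1, u j)) <= (r1 - 2 * r0) / 2.
  move=> iN jN; apply/ltW/Hd'.
  - by split; rewrite /= in_itv /= u01 // ltnW.
  - by split; rewrite /= in_itv /= u01.
  - by split; [rewrite -ball_normE; exact: uSd'|exact: ballxx].
have Hleft i : (i <= n.+1)%N -> H (u i, u 0%N) = x.
  by move=> iN; rewrite u0 (Hends _ _).1 ?in_itv //= u01.
have Hright i : (i <= n.+1)%N -> H (u i, u n.+1) = x.
  by move=> iN; rewrite u1 (Hends _ _).2 ?in_itv //= u01.
have ax : mdist (act a o) x <= r0 by rewrite -f0 -c0; apply: fc; lra.
have bx : mdist (act b o) x <= r0 by rewrite -f1 -c1; apply: fc; lra.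
have close g h : mdist (act g o) x <= r0 -> mdist (act h o) x <= r0 ->
    mdist (act g o) (act h o) <= r1.
  move=> gx hx; have := mdist_of_near gx hx; rewrite mdistxx.
  by have := r0r1; lra.
(* The end of a lift of row [i] starting at [a] is the same for all rows, up to
   adjacency; the last row is constant and lifts to the constant [a]. *)
have rows i : (i <= n.+1)%N -> exists a' : nat -> G, [/\ a' 0%N = a,
    forall j, (j <= n.+1)%N -> mdist (act (a' j) o) (H (u i, u j)) <= r0,
    forall j, (j < n.+1)%N -> adjacent (a' j) (a' j.+1) &
    adjacent (a' n.+1) b].
  elim: i => [_|i IH iN].
    (* Row [0] is the loop itself, and the sampled lift [f] ends exactly at [b]. *)
    exists (f \o u); split => /=.
    - by rewrite u0.
    - by move=> j jN; rewrite u0 H0 ?in_itv /= ?u01 //; exact/fc/u01.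
    - by move=> j jN; apply: fd; rewrite ?u01 ?ltW // ltnW.
    - by rewrite u1 f1; exact: adjacent_refl.
  have [a1 [a10 a1H a1S a1b]] := IH (ltnW iN).
  have [|a2 [a20 a2H a2S]] := @discrete_lift (fun j => H (u i.+1, u j)) a n.+1 _
    (fun j => @HS i.+1 j iN).
    by rewrite Hleft.
  exists a2; split => //.
  have a12 : adjacent (a1 n.+1) (a2 n.+1).
    apply: (adjacent_lifts (fun j => @HS i j (ltnW iN))
      (fun j => @SH i j iN) a1H a2H a1S a2S) => //.
    by rewrite a10 a20; exact: adjacent_refl.
  (* Every row ends at [x], so the centers of the end lifts are within [2 * r0] of each other. *)
  apply: adjacent_trans (adjacent_sym a12) a1b _.
  by apply: close => //; rewrite -(Hright i.+1 iN); exact: a2H.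
have [a' [a'0 a'H a'S a'b]] := rows n.+1 (leqnn _).
have Hx j : (j <= n.+1)%N -> H (u n.+1, u j) = x.
  by move=> jN; rewrite u1 H1 ?in_itv ?u01.
have aa' : adjacent a (a' n.+1).
  apply: (@adjacent_lifts (fun=> x) (fun=> x) (fun=> a) a' n.+1) => //.
  - by move=> j _; rewrite mdistxx ltW.
  - by move=> j _; rewrite mdistxx ltW.
  - by move=> j jN; rewrite -(Hx j jN); exact: a'H.
  - by move=> j _; exact: adjacent_refl.
  - by rewrite a'0; exact: adjacent_refl.
by apply: adjacent_trans aa' a'b _; exact: close.
Qed.

(** * Group elements moving the base point by at most [r1] *)

Lemma close_in_generators g : simply_connected_space R X ->
  mdist (act g o) o <= r1 -> S g.
Proof.
move=> scX go; have [m om gm] := geodesic_midpoint o (act g o).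
have og : mdist o (act g o) <= r1 by rewrite metric_sym.
have om1 : mdist (act 1%g o) m <= r1 / 2 by rewrite act1; lra.
have gm1 : mdist (act g o) m <= r1 / 2 by lra.
have [b b1 bm] := adjacent_near om1.
have [b' gb' b'm] := adjacent_near gm1.
have r1b := reach_center om1 b1 bm.
(* The loop based at [m] goes to [0], then to [g.0] along a word in [S], then back to [m]; its lift
   passes through [1] and [g], from [b] to [b']. *)
have bb' : adjacent b b'.
  apply: (reach_loop scX); apply: reach_trans r1b _; rewrite act1.
  apply: reach_trans (reach_group g) _.
  exact/reach_sym/reach_center.
(* The remaining chain [1], [b], [b'], [g] is shortened one link at a time: the center of [b'] is
   within [r1 / 2 + r0 < r1] of [0], and that of [g] is within [r1] by assumption. *)
have b'1 : adjacent 1%g b'.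
  apply: adjacent_trans b1 bb' _.
  have := metric_triangle (act 1%g o) m (act b' o).
  by rewrite (metric_sym m); have := r0r1; lra.
suff : adjacent 1%g g by rewrite /adjacent invg1 mul1g.
by apply: adjacent_trans b'1 (adjacent_sym gb') _; rewrite act1.
Qed.

End Chambers.

Theorem theorem2p1 (R : realType) (G : groupType) (X : metricType R)
    (act : G -> X -> X) (S : set G) (o : X) (r0 r1 : R) :
  simply_connected_space R X ->
  geodesic_space X ->
  isometric_action act ->
  finite_set S ->
  S !=set0 ->
  symmetric_subset S ->
  generated_subgroup S = [set: G] ->
  has_ubound [set mdist o x | x in FS act o S] ->
  r0 = sup [set mdist o x | x in FS act o S] ->
  2 * r0 < r1 ->
  (forall g, S g -> mdist (act g o) o <= r1) ->
  (forall g g', S g -> S g' -> mdist (act (g * g')%g o) o <= r1 ->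
    S (g * g')%g) ->
  S = [set g | mdist (act g o) o <= r1].
Proof.
move=> scX geoX actI Sfin S0 Ssym Sgen FSub r0E r0r1 Sball Smul.
apply/seteqP; split => g; first exact: Sball.
apply: close_in_generators r0r1 _ _ _ scX => // x FSx.
by rewrite r0E; apply: sup_ubound => //; exists x.
Qed.
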